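(* Let $N_r\ge 1$, let $\mathcal{S}$ be a nonempty finite index set (the selected users), let $P>0$, and let $\mathbf{h}_i\in\mathbb{C}^{N_r}$, $i\in\mathcal{S}$, be vectors with $\|\mathbf{h}_i\|=1$ for all $i\in\mathcal{S}$. Let $$\mathrm{obj}^*=\max_{\mathbf{m}\in\mathbb{C}^{N_r},\ \|\mathbf{m}\|=1}\ \min_{k\in\mathcal{S}} P\,|\mathbf{m}^{\mathsf{H}}\mathbf{h}_k|^2$$ and let $\alpha=\max_{i,j\in\mathcal{S}}\arccos|\mathbf{h}_i^{\mathsf{H}}\mathbf{h}_j|\in[0,\tfrac{\pi}{2}]$. Then $\mathrm{obj}^*\ge P\cos^2\alpha$.
   Context: $(\cdot)^{\mathsf{H}}$ denotes conjugate transpose and $\|\cdot\|$ the Euclidean norm on $\mathbb{C}^{N_r}$. The vector $\mathbf{h}_i$ is the channel of user $i$, $\mathbf{m}$ is the receive beam steering vector, and $P$ is the maximum transmit power. *)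

(* Defs.v *)
From HB Require Import structures.
From mathcomp Require Export all_boot all_order all_algebra.
From mathcomp Require Export complex.
From mathcomp Require Export boolp classical_sets reals trigo.

Set Implicit Arguments.
Unset Strict Implicit.
Unset Printing Implicit Defensive.

Import Order.TTheory GRing.Theory Num.Theory.
Import ComplexField.

Local Open Scope classical_set_scope.
Local Open Scope ring_scope.
Local Open Scope complex_scope.
Local Open Scope sesquilinear_scope.

Section Defs.
Variable R : realType.

(* [Normc.normc z] is the modulus of z as an element of R (the norm [`|z|]
   of MathComp takes its values in R[i]). *)
Definition norm2 (n : nat) (x : 'cV[R[i]]_n) : R :=
  Num.sqrt (\sum_i Normc.normc (x i ord0) ^+ 2).

(* [u^t*] is the conjugate transpose of u. *)
Definition hdot (n : nat) (u v : 'cV[R[i]]_n) : R[i] :=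
  (u^t* *m v) ord0 ord0.

(* The index type is nonempty because of its element i0.  Since f i0 is one of
   the terms, using it as initial value does not change the minimum (maximum),
   and the result does not depend on i0. *)
Definition finmin (I : finType) (i0 : I) (f : I -> R) : R :=
  \big[Num.min/f i0]_i f i.
Definition finmax (I : finType) (i0 : I) (f : I -> R) : R :=
  \big[Num.max/f i0]_i f i.

Definition is_max (A : set R) (x : R) : Prop := A x /\ ubound A x.

Definition unit_sphere (n : nat) : set 'cV[R[i]]_n := [set m | norm2 m = 1].

Definition obj (n : nat) (S : finType) (i0 : S) (P : R) (h : S -> 'cV[R[i]]_n)
    (m : 'cV[R[i]]_n) : R :=
  finmin i0 (fun k => P * Normc.normc (hdot m (h k)) ^+ 2).

Definition max_angle (n : nat) (S : finType) (i0 : S)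
    (h : S -> 'cV[R[i]]_n) : R :=
  finmax (i0, i0) (fun ij : S * S =>
    acos (Normc.normc (hdot (h ij.1) (h ij.2)))).

End Defs.

Arguments unit_sphere : clear implicits.

(* Main.v *)
(* Compactness of the unit sphere yields a maximizer of the continuous
   objective.  For the bound, test the objective at m = h i0: every angle
   arccos |h_{i0}^H h_k| is at most alpha <= pi / 2, and cos is decreasing. *)
Require Import Defs.
From mathcomp Require Import functions topology normedtype derive realfun.
From mathcomp Require Import ring lra.
Set Implicit Arguments.
Unset Strict Implicit.
Import Order.TTheory GRing.Theory Num.Theory.
Import numFieldNormedType.Exports.
Local Open Scope classical_set_scope.
Local Open Scope ring_scope.
Local Open Scope complex_scope.

Section Scalars.
Variable R : realType.
Implicit Types z : R[i].

Lemma normc_ge0 z : 0 <= Normc.normc z.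
Proof. by case: z => a b; exact: sqrtr_ge0. Qed.

Lemma normc_sum (I : finType) (F : I -> R[i]) :
  Normc.normc (\sum_i F i) <= \sum_i Normc.normc (F i).
Proof.
elim/big_ind2: _ => [|x1 y1 x2 y2 h1 h2|//]; first by rewrite Normc.normc0.
exact: le_trans (le_normcD _ _) (lerD h1 h2).
Qed.

Lemma normc_conj z : Normc.normc z^* = Normc.normc z.
Proof. by case: z => a b /=; rewrite sqrrN. Qed.

Lemma normc_Re z : `|complex.Re z| <= Normc.normc z.
Proof.
by case: z => a b /=; rewrite -sqrtr_sqr ler_wsqrtr// lerDl sqr_ge0.
Qed.

Lemma normc_Im z : `|complex.Im z| <= Normc.normc z.
Proof.
by case: z => a b /=; rewrite -sqrtr_sqr ler_wsqrtr// lerDr sqr_ge0.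
Qed.

Lemma continuous_sqr (T : topologicalType) (f : T -> R) :
  continuous f -> continuous (fun x => f x ^+ 2).
Proof. by move=> cf x; apply: cvgM; exact: cf. Qed.

Lemma continuous_lincomb (T : topologicalType) (f g : T -> R) (a b : R) :
  continuous f -> continuous g -> continuous (fun x => f x * a + g x * b).
Proof.
by move=> cf cg x; apply: cvgD; apply: cvgMl; [exact: cf|exact: cg].
Qed.

Lemma continuous_normc (T : topologicalType) (f g : T -> R) :
  continuous f -> continuous g ->
  continuous (fun x => Normc.normc (f x +i* g x)).
Proof.
move=> cf cg x; rewrite /Normc.normc.
apply: (@continuous_comp _ _ _ (fun x => f x ^+ 2 + g x ^+ 2) Num.sqrt).
  2: exact: sqrt_continuous.
by apply: cvgD; [apply: cvgM; exact: cf|apply: cvgM; exact: cg].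
Qed.

Lemma continuous_sumr (T : topologicalType) (I : finType) (F : I -> T -> R) :
  (forall i, continuous (F i)) -> continuous (fun x => \sum_i F i x).
Proof.
move=> cF; apply: continuous_big => [|i _]; last exact: cF.
exact: add_continuous.
Qed.

(** Induction along the enumeration of [I], since a binary minimum of continuous functions is
    continuous. The initial value of the fold is [F i0 x], which varies with [x], so the empty list
    already calls for continuity of [F i0]. *)
Lemma continuous_finmin (T : topologicalType) (I : finType) (i0 : I)
    (F : I -> T -> R) :
  (forall i, continuous (F i)) -> continuous (fun x => finmin i0 (F^~ x)).
Proof.
move=> cF; rewrite /finmin => x.
elim: (index_enum I) => [|i s IHs].
  by under eq_fun do rewrite big_nil; exact: cF.
under eq_fun do rewrite big_cons.
exact: (continuous_min (cF i x) IHs).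
Qed.

End Scalars.

Section Vectors.
Variables (R : realType) (n : nat).
Implicit Types u v : 'cV[R[i]]_n.

Lemma hdot_sum u v :
  hdot u v = \sum_j ((u j ord0)^* * v j ord0).
Proof. by rewrite /hdot mxE; apply: eq_bigr => j _; rewrite !mxE. Qed.

Lemma sum_normc_sqr u :
  norm2 u = 1 -> \sum_i Normc.normc (u i ord0) ^+ 2 = 1.
Proof.
move=> u1; rewrite -[LHS]sqr_sqrtr ?sumr_ge0// => [|i _]; last exact: sqr_ge0.
by rewrite [Num.sqrt _]u1 expr1n.
Qed.

(** Cauchy-Schwarz for unit vectors. Each term satisfies [a * b <= (a ^+ 2 + b ^+ 2) / 2], from the
    square of [a - b], and these bounds sum to (1 + 1) / 2 = 1. *)
Lemma normc_hdot_le1 u v :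
  norm2 u = 1 -> norm2 v = 1 -> Normc.normc (hdot u v) <= 1.
Proof.
move=> /sum_normc_sqr u1 /sum_normc_sqr v1; rewrite hdot_sum.
apply: le_trans (normc_sum _) _.
have -> : 1 = \sum_j (Normc.normc (u j ord0) ^+ 2 +
                      Normc.normc (v j ord0) ^+ 2) / 2 :> R.
  by rewrite -mulr_suml big_split/= u1 v1; lra.
apply: ler_sum => j _; rewrite Normc.normcM normc_conj.
have := sqr_ge0 (Normc.normc (u j ord0) - Normc.normc (v j ord0)).
by nra.
Qed.

Lemma normc_coord_le_norm2 u i : Normc.normc (u i ord0) <= norm2 u.
Proof.
rewrite -[leLHS]ger0_norm ?normc_ge0// -sqrtr_sqr ler_wsqrtr//.
by rewrite (bigD1 i)//= lerDl sumr_ge0// => j _; exact: sqr_ge0.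
Qed.

(** Identifies real 2n-space with complex n-space, real parts in the first half and imaginary parts
    in the second, so that compactness and extreme value results for real row vectors apply. *)
Definition complex_of_real_coords (x : 'rV[R]_(n + n)) : 'cV[R[i]]_n :=
  \col_i (x ord0 (lshift n i) +i* x ord0 (rshift n i)).

Definition real_coords u : 'rV[R]_(n + n) :=
  row_mx (\row_i complex.Re (u i ord0)) (\row_i complex.Im (u i ord0)).

Lemma real_coordsK : cancel real_coords complex_of_real_coords.
Proof.
move=> u; apply/colP => i; rewrite mxE row_mxEl row_mxEr !mxE.
by case: (u i ord0).
Qed.

Let coord_cont (k : 'I_(n + n)) :
  continuous (fun x : 'rV[R]_(n + n) => x ord0 k).
Proof. exact: coord_continuous. Qed.

Lemma continuous_norm2 :
  continuous (fun x => norm2 (complex_of_real_coords x)).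
Proof.
move=> x; apply: (@continuous_comp _ _ _ (fun x => \sum_i
    Normc.normc (complex_of_real_coords x i ord0) ^+ 2) Num.sqrt).
  2: exact: sqrt_continuous.
apply: continuous_sumr => i {}x.
have -> : (fun y => Normc.normc (complex_of_real_coords y i ord0) ^+ 2) =
    fun y => Normc.normc (y ord0 (lshift n i) +i* y ord0 (rshift n i)) ^+ 2.
  by apply/funext => y; rewrite mxE.
have cN :=
  continuous_normc (@coord_cont (lshift n i)) (@coord_cont (rshift n i)).
exact: (continuous_sqr cN).
Qed.

Lemma continuous_normc_hdot v :
  continuous (fun x => Normc.normc (hdot (complex_of_real_coords x) v)).
Proof.
pose l i (x : 'rV[R]_(n + n)) := x ord0 (lshift n i).
pose r i (x : 'rV[R]_(n + n)) := x ord0 (rshift n i).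
pose a i := complex.Re (v i ord0).
pose b i := complex.Im (v i ord0).
(* Expanding (l - ir)(a + ib) in each coordinate gives real part la + rb and imaginary part lb - ra,
   both linear in the real coordinates. *)
have -> : (fun x => Normc.normc (hdot (complex_of_real_coords x) v)) =
    fun x => Normc.normc ((\sum_i (l i x * a i + r i x * b i)) +i*
                          (\sum_i (l i x * b i + r i x * - a i))).
  apply/funext => x; congr Normc.normc; rewrite hdot_sum.
  apply/eqP; rewrite eq_complex !raddf_sum/=; apply/andP.
  by split; apply/eqP; apply: eq_bigr => i _; rewrite mxE /l /r /a /b;
    case: (v i ord0) => c d /=; ring.
apply: continuous_normc; apply: continuous_sumr => i;
  exact: continuous_lincomb (@coord_cont _) (@coord_cont _).
Qed.

(** Heine-Borel: the set is closed as the preimage of 1 under a continuous map, and bounded because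
    each real coordinate is at most the modulus of a complex one, hence at most 1. *)
Lemma compact_real_sphere :
  compact [set x | norm2 (complex_of_real_coords x) = 1].
Proof.
apply: bounded_closed_compact; last first.
  apply: (@preimage_closed _ _ _ [set 1 : R]) => [x _|].
    exact: continuous_norm2.
  exact: closed_eq.
exists 1; split=> // M M1 x /= x1.
(* The norm on row vectors is the maximum of the absolute entries with initial value 0, so [0 <= M]
   is checked beside the entrywise bounds. *)
rewrite /Num.norm/= mx_normrE; apply/bigmax_leP; split=> [|[i j] _ /=].
  by rewrite (le_trans ler01) ?ltW.
apply: le_trans (ltW M1); rewrite -x1 (ord1 i).
case: (splitP j) => k jk.
- have -> : j = lshift n k by exact: val_inj.
  apply: le_trans (normc_coord_le_norm2 _ k); apply: le_trans (normc_Re _).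
  by rewrite mxE.
- have -> : j = rshift n k by exact: val_inj.
  apply: le_trans (normc_coord_le_norm2 _ k); apply: le_trans (normc_Im _).
  by rewrite mxE.
Qed.

(** The extreme value theorem is applied on the real sphere and transported back through
    [real_coordsK]. Nonemptiness excludes dimension 0, where no vector has norm 1. *)
Lemma obj_max_exists (S : finType) (i0 : S) (P : R) (h : S -> 'cV[R[i]]_n) :
  unit_sphere R n !=set0 ->
  exists o, is_max [set obj i0 P h m | m in unit_sphere R n] o.
Proof.
move=> [m0 m01].
pose f x := obj i0 P h (complex_of_real_coords x).
have cf : continuous f.
  apply: continuous_finmin => k x.
  have cN := continuous_sqr (@continuous_normc_hdot (h k)).
  exact: (continuousM (@cst_continuous _ _ P x) (cN x)).
have [||x xA fx] := EVT_max_rV _ compact_real_sphere (f := f).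
- by exists (real_coords m0); rewrite /= real_coordsK.
- exact: continuous_subspaceT.
exists (f x); split.
  by exists (complex_of_real_coords x) => //; move: xA; rewrite inE.
move=> _ [m m1 <-]; rewrite -(real_coordsK m); apply: fx.
by rewrite inE /= real_coordsK.
Qed.

End Vectors.

Theorem corollary5p1p1 (R : realType) (Nr : nat) (hNr : (0 < Nr)%N)
    (S : finType) (i0 : S) (P : R) (hP : 0 < P)
    (h : S -> 'cV[R[i]]_Nr) (hh : forall i : S, norm2 (h i) = 1) :
  let alpha := max_angle i0 h in
  (0 <= alpha <= pi / 2) /\
  exists obj_star : R,
    is_max [set obj i0 P h m | m in unit_sphere R Nr] obj_star /\
    obj_star >= P * cos alpha ^+ 2.
Proof.
move=> alpha.
pose c i j := Normc.normc (hdot (h i) (h j)).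
have c0 i j : 0 <= c i j by exact: normc_ge0.
have c1 i j : c i j <= 1 by exact: normc_hdot_le1.
have cI i j : -1 <= c i j <= 1.
  by rewrite c1 andbT (le_trans _ (c0 i j))// lerN10.
have cosK i j : cos (acos (c i j)) = c i j by rewrite acosK// in_itv/= cI.
(* An angle beyond [pi / 2] would have a negative cosine, because cos strictly decreases on [0, pi];
   but this cosine is the modulus [c i j]. *)
have acos_pihalf i j : acos (c i j) <= pi / 2.
  rewrite leNgt; apply/negP => lt_pihalf.
  have := c0 i j; rewrite -cosK leNgt -cos_pihalf ltr_cos ?lt_pihalf//.
  - by rewrite in_itv/=; have := pi_ge0 R; lra.
  - by rewrite in_itv/= acos_ge0// acos_lepi.
have acos_alpha i j : acos (c i j) <= alpha.
  exact: (le_bigmax _ (fun ij : S * S => acos (c ij.1 ij.2)) (i, j)).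
have alpha0 : 0 <= alpha := le_trans (acos_ge0 (cI i0 i0)) (acos_alpha i0 i0).
have alphapi2 : alpha <= pi / 2.
  by apply: bigmax_le => [|ij _]; exact: acos_pihalf.
split; first by rewrite alpha0.
have [|o omax] := obj_max_exists i0 P h; first by exists (h i0); exact: hh.
exists o; split=> //.
apply: le_trans (omax.2 (obj i0 P h (h i0)) _).
  2: by exists (h i0) => //; exact: hh.
(* Nonnegativity allows squaring the inequality [cos alpha <= c i0 k] below; it relies on
   [alpha <= pi / 2]. *)
have cos0 : 0 <= cos alpha.
  apply: cos_ge0_pihalf; rewrite alphapi2 andbT (le_trans _ alpha0)// oppr_le0.
  by rewrite divr_ge0// pi_ge0.
have obj_ge k : P * cos alpha ^+ 2 <= P * c i0 k ^+ 2.
  rewrite ler_pM2l// lerXn2r// ?nnegrE// -cosK leNgt.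
  rewrite ltr_cos ?ltNge ?acos_alpha//.
  - by rewrite in_itv/= alpha0/=; have := pi_ge0 R; lra.
  - by rewrite in_itv/= acos_ge0// acos_lepi.
(* The initial value of the minimum is its term at [i0], so [obj_ge] bounds it as well as every
   other term. *)
by apply: le_bigmin => [|k _]; exact: obj_ge.
Qed.
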